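(* Let $\mathcal{A}=(A,F)$ be a finite unary algebra. The number of non-isomorphic countable subdirect powers of $\mathcal{A}$ is countable if and only if every operation $f\in F$ is either a bijection $A\to A$ or a constant mapping.
   Context: A unary algebra is a structure $\mathcal{A}=(A,F)$ where $A$ is a set (the carrier set) and $F$ is a set of unary operations $f:A\to A$; it is finite if $A$ is finite. A subdirect power of $\mathcal{A}$ is a subalgebra $P$ of a cartesian power $\mathcal{A}^X$ (for some index set $X$, with operations of $F$ acting coordinatewise) such that $P$ projects onto $A$ in every coordinate. It is a countable subdirect power if $|P|\leq\aleph_0$. Isomorphism means isomorphism of algebras with operations indexed by $F$, and the number of subdirect powers is counted up to isomorphism. ''Countable'' means finite or of size $\aleph_0$. *)

(* Defs.v *)
From mathcomp Require Import all_boot.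
From mathcomp Require Import all_classical.

Set Implicit Arguments.
Unset Strict Implicit.
Unset Printing Implicit Defensive.

Local Open Scope classical_set_scope.

(* A finite unary algebra is a finite type A with a set F of maps A -> A; as A
   is finite, every set of such maps is a {set {ffun A -> A}}. The index set X
   is arbitrary: it may be empty, or infinite of any cardinality. *)
Record countableSubdirectPower (A : finType) (F : {set {ffun A -> A}}) :=
  CountableSubdirectPower {
    index_set : Type;
    universe : set (index_set -> A);
    universe_closed : forall f : {ffun A -> A}, f \in F ->
      forall p, universe p -> universe (f \o p);
    universe_onto : forall x : index_set, [set p x | p in universe] = setT;
    universe_countable : countable universe
  }.

Arguments universe {A F} c.

Definition op (A : finType) (F : {set {ffun A -> A}})
    (P : countableSubdirectPower F) (f : {ffun A -> A}) (fF : f \in F)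
    (p : universe P) : universe P :=
  SigSub (mem_set (universe_closed fF (set_mem (valP p)))).

Definition isomorphic (A : finType) (F : {set {ffun A -> A}})
    (P Q : countableSubdirectPower F) : Prop :=
  exists phi : universe P -> universe Q,
    bijective phi /\
    forall (f : {ffun A -> A}) (fF : f \in F) (p : universe P),
      phi (op fF p) = op fF (phi p).

Definition iso_class (A : finType) (F : {set {ffun A -> A}})
    (P : countableSubdirectPower F) : set (countableSubdirectPower F) :=
  [set Q | isomorphic P Q].

(* Main.v *)
Require Import Defs.
From mathcomp Require Import all_boot.
From mathcomp Require Import all_fingroup.
From mathcomp Require Import all_classical.

Set Implicit Arguments.
Unset Strict Implicit.
Unset Printing Implicit Defensive.

Local Open Scope classical_set_scope.

(** Suppose first that every operation in [F] is a bijection or a constant.  The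
    bijections in [F] generate a finite group of permutations of [A], and every
    subdirect power [P] is a disjoint union of orbits of this group.  Choose a
    representative in each orbit and record, for each subset [B] of [A], how many
    representatives have range [B]: this is a finite table of cardinals that are
    at most countable, so there are countably many tables ([census]).  The table
    determines [P] up to isomorphism ([census_isomorphic]): match the
    representatives [r] of [P] with representatives [r'] of [Q] of the same range,
    and send [s \o r] to [s \o r'].  This is well defined and injective because
    two permutations agree after [r] exactly when they agree on its range; it
    respects constant operations because it preserves ranges.

    Conversely, let [f] in [F] be neither injective nor constant, and let
    [s : nat -> nat] be positive.  Take elements [gen k i], [i < s k], that are
    generic subject to the single condition that [f \o gen k i] depends only on
    the block [k], and let [power s] consist of all [g \o gen k i] with [g] an
    arbitrary map from [A] to [A].  Closing under all maps makes it a subdirect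
    power whatever the rest of [F] is, and leaves only the fibres of [f] to be
    counted.  With [N] the number of maps from [A] to [A], the fibre over a
    constant element has at most one element or is infinite ([fibre_const]); any
    other fibre lies in one block [k] ([fibre_block]) and has at most [N] elements
    or between [s k] and [N * s k] ([fibre_dichotomy], [fibre_upper]); the fibre
    over [f \o gen k 0] has at least [s k].  If every [s k] is either [1] or
    [N.+1 ^ k.+1], the sizes of the finite fibres of [f] tell which [s k] are
    large ([markedE]).  Hence there are at least as many isomorphism classes as subsets of
    [nat]. *)

(** * Bijections and constants: countably many powers *)

Section BijectiveOrConstant.
Local Open Scope card_scope.
Context (A : finType) (F : {set {ffun A -> A}}).

Definition bijGroup : {set {perm A}} :=
  <<[set s : {perm A} | [ffun a => s a] \in F]%SET>>%g.

(** The permutations that preserve [universe P] form a group: in a finite group,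
    closure under products suffices. *)
Lemma universe_perm (P : countableSubdirectPower F) (s : {perm A})
    (p : index_set P -> A) :
  s \in bijGroup -> universe P p -> universe P (s \o p).
Proof.
pose H := [set s : {perm A} |
  `[< forall p, universe P p -> universe P (s \o p) >]]%SET.
have gH : group_set H.
  apply/group_setP; split=> [|t u]; rewrite !inE.
    by apply/asboolP => q Pq; rewrite (_ : _ \o q = q) //; apply/funext => x /=;
      rewrite perm1.
  move=> /asboolP Ht /asboolP Hu; apply/asboolP => q Pq.
  rewrite (_ : _ \o q = u \o (t \o q)); first exact/Hu/Ht.
  by apply/funext => x /=; rewrite permM.
suff /fintype.subsetP sub : bijGroup \subset H.
  by move=> /sub; rewrite inE => /asboolP; apply.
rewrite (gen_subG _ (Group gH)); apply/fintype.subsetP => t; rewrite !inE => tF.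
apply/asboolP => q Pq; have := universe_closed tF Pq.
by congr universe; apply/funext => x /=; rewrite ffunE.
Qed.

Definition perm_orbit (X : Type) (p : X -> A) : set (X -> A) :=
  [set q | exists2 s : {perm A}, s \in bijGroup & q = s \o p].

Lemma perm_orbit_refl (X : Type) (p : X -> A) : perm_orbit p p.
Proof. by exists 1%g; [exact: group1 | apply/funext => x /=; rewrite perm1]. Qed.

Lemma perm_orbit_eq (X : Type) (p q : X -> A) :
  perm_orbit p q -> perm_orbit q = perm_orbit p.
Proof.
move=> [s sG ->]; apply/seteqP; split=> _ [t tG ->].
  by exists (s * t)%g; [exact: groupM | apply/funext => x /=; rewrite permM].
exists (s^-1 * t)%g; first by rewrite groupM ?groupV.
by apply/funext => x /=; rewrite permM permK.
Qed.

Definition orbit_rep (X : Type) (p : X -> A) : X -> A := xget p (perm_orbit p).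

Lemma perm_orbit_rep (X : Type) (p : X -> A) : perm_orbit p (orbit_rep p).
Proof.
by rewrite /orbit_rep; case: xgetP => [q _ //|/(_ p)] []; apply: perm_orbit_refl.
Qed.

(** Equal orbits are equal sets, so the choice made by [xget] in them agrees; the
    default value is harmless because orbits are inhabited. *)
Lemma orbit_rep_eq (X : Type) (p q : X -> A) :
  perm_orbit p q -> orbit_rep q = orbit_rep p.
Proof.
move=> pq; rewrite /orbit_rep (perm_orbit_eq pq).
rewrite /xget; case: pselect => // -[].
by exists p; apply/asboolP; apply: perm_orbit_refl.
Qed.

Definition finrange (X : Type) (p : X -> A) : {set A} :=
  [set a | `[< exists x, p x = a >]]%SET.

Lemma finrange_in (X : Type) (p : X -> A) x : p x \in finrange p.
Proof. by rewrite inE; apply/asboolP; exists x. Qed.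

Lemma finrange_comp (X Y : Type) (p : X -> A) (q : Y -> A) (m : A -> A) :
  finrange p = finrange q -> finrange (m \o p) = finrange (m \o q).
Proof.
move=> e; have im2 (Z : Type) (r : Z -> A) :
    finrange (m \o r) = [set m a | a in finrange r]%SET.
  apply/setP => b; rewrite inE; apply/asboolP/imsetP => [[x <-]|[a]].
    by exists (r x) => //; apply: finrange_in.
  by rewrite inE => /asboolP[x <-] ->; exists x.
by rewrite !im2 e.
Qed.

(** Equality of [m \o p] and [n \o p] means that [m] and [n] agree on the range
    of [p].  This is what allows elements of two different powers to be exchanged
    as soon as they have the same range. *)
Lemma finrange_agree (X Y : Type) (p : X -> A) (q : Y -> A) (m n : A -> A) :
  finrange p = finrange q -> m \o p = n \o p -> m \o q = n \o q.
Proof.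
move=> e mn; apply/funext => y /=.
have: q y \in finrange p by rewrite e finrange_in.
rewrite inE => /asboolP[x <-].
by have := congr1 (fun h : X -> A => h x) mn.
Qed.

Definition orbit_reps (P : countableSubdirectPower F) (B : {set A}) :
    set (index_set P -> A) :=
  [set r | [/\ universe P r, orbit_rep r = r & finrange r = B]].

(** A set of each cardinality that is at most countable, [None] standing for the
    infinite one. *)
Definition cardinal_set (o : option nat) : set nat :=
  if o is Some n then `I_n else setT.

Lemma countable_cardinal_set (T : Type) (E : set T) :
  countable E -> exists o, E #= cardinal_set o.
Proof.
move=> cE; have [[n En]|/infiniteP iE] := pselect (finite_set E).
  by exists (Some n).
by exists None; rewrite card_eq_le iE andbT.
Qed.

Lemma census_exists (P : countableSubdirectPower F) :
  exists t : {ffun {set A} -> option nat},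
  forall B, @orbit_reps P B #= cardinal_set (t B).
Proof.
have /choice[t tP] (B : {set A}) : exists o, @orbit_reps P B #= cardinal_set o.
  apply: countable_cardinal_set; apply: sub_countable (universe_countable P).
  by apply: subset_card_le => r [].
by exists [ffun B => t B] => B; rewrite ffunE.
Qed.

(** Not an isomorphism invariant, since it may depend on the chosen orbit
    representatives; it is only used in the direction of [census_isomorphic]. *)
Definition census (P : countableSubdirectPower F) : {ffun {set A} -> option nat} :=
  sval (cid (census_exists P)).

(** Equipotence as a relation instead of a function: no value outside [C] has to
    be invented, which matters when [U] is empty. *)
Lemma card_eq_matching (T U : Type) (C : set T) (D : set U) : C #= D ->
  exists R : T -> U -> Prop,
  [/\ forall t u, R t u -> C t /\ D u,
      forall t, C t -> exists u, R t u,
      forall u, D u -> exists t, R t u,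
      forall t u u', R t u -> R t u' -> u = u' &
      forall t t' u, R t u -> R t' u -> t = t'].
Proof.
move=> /card_bijP[f [g fK gK]].
exists (fun t u => exists2 x, val x = t & val (f x) = u); split.
- by move=> _ _ [x <- <-]; split; apply: set_valP.
- by move=> t Ct; exists (val (f (SigSub (mem_set Ct)))), (SigSub (mem_set Ct)).
- by move=> u Du; exists (val (g (SigSub (mem_set Du)))), (g (SigSub (mem_set Du)));
    rewrite ?gK.
- by move=> _ _ _ [x <- <-] [y /val_inj -> <-].
- by move=> _ _ _ [x <- <-] [y <- /val_inj/(can_inj fK) ->].
Qed.

Lemma bijective_of_matching (T U : Type) (R : T -> U -> Prop) :
  (forall t, exists u, R t u) -> (forall u, exists t, R t u) ->
  (forall t u u', R t u -> R t u' -> u = u') ->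
  (forall t t' u, R t u -> R t' u -> t = t') ->
  exists2 f : T -> U, bijective f & forall t, R t (f t).
Proof.
move=> /choice[f fP] /choice[g gP] Rf Ri; exists f => //; exists g => x.
  exact: Ri (gP _) (fP _).
exact: Rf (fP _) (gP _).
Qed.

Hypothesis bij_or_const : forall f : {ffun A -> A}, f \in F ->
  bijective f \/ exists c : A, forall a : A, f a = c.

(** The map sending [s \o r] to [s \o r'] for matched representatives [r] and [r'],
    again as a relation, so that its inverse is the same construction with [P] and
    [Q] exchanged. *)
Section Matching.
Context (P Q : countableSubdirectPower F)
  (R : (index_set P -> A) -> (index_set Q -> A) -> Prop).
Hypotheses (Rim : forall r r', R r r' -> finrange r = finrange r')
  (Rrep : forall r r', R r r' -> orbit_rep r = r)
  (Runiv : forall r r', R r r' -> universe Q r')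
  (Rtot : forall r, universe P r -> orbit_rep r = r -> exists r', R r r')
  (Rfun : forall r r' r'', R r r' -> R r r'' -> r' = r'').

Definition extend (p : universe P) (q : universe Q) :=
  exists s r r', [/\ s \in bijGroup, R r r', val p = s \o r & val q = s \o r'].

Lemma extend_total p : exists q, extend p q.
Proof.
have [s sG pE] := perm_orbit_rep (val p).
have Pr : universe P (orbit_rep (val p)).
  by rewrite pE; apply: universe_perm sG _; apply: set_valP.
have [r' Rr] := Rtot Pr (orbit_rep_eq (perm_orbit_rep (val p))).
have sVG : s^-1%g \in bijGroup by rewrite groupV.
exists (SigSub (mem_set (universe_perm sVG (Runiv Rr)))), s^-1%g, (orbit_rep (val p)), r'.
by split=> //; rewrite pE; apply/funext => x /=; rewrite permK.
Qed.

Lemma extend_finrange p q : extend p q -> finrange (val p) = finrange (val q).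
Proof. by move=> [s [r [r' [_ /Rim e -> ->]]]]; apply: finrange_comp. Qed.

(** If [s \o r = u \o t], then [r] and [t] are representatives of the same orbit,
    hence equal, and [finrange_agree] carries the equation over to [Q]. *)
Lemma extend_fun p q q' : extend p q -> extend p q' -> q = q'.
Proof.
move=> [s [r [r' [sG Rr pE qE]]]] [u [t [t' [uG Rt pE' qE']]]].
have rt : r = t.
  rewrite -(Rrep Rr) -(Rrep Rt).
  rewrite -(@orbit_rep_eq _ r (val p)) -?(@orbit_rep_eq _ t (val p)) //.
    by exists u.
  by exists s.
subst t; have ? := Rfun Rr Rt; subst t'.
apply/val_inj; rewrite qE qE'; apply: finrange_agree (Rim Rr) _.
by rewrite -pE.
Qed.

(** A bijection is absorbed in the permutation [s].  For a constant operation,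
    [op fF p] is related to some element of [Q]; having the same range, that
    element is constant with the same value. *)
Lemma extend_op f (fF : f \in F) p q : extend p q -> extend (op fF p) (op fF q).
Proof.
move=> pq; have [bf|[c fc]] := bij_or_const fF.
  case: pq => [s [r [r' [sG Rr pE qE]]]].
  exists (s * perm (bij_inj bf))%g, r, r'; split=> //=.
  - apply: groupM => //; apply: mem_gen; rewrite inE.
    by rewrite (_ : [ffun _ => _] = f) //; apply/ffunP => a; rewrite ffunE permE.
  - by rewrite pE; apply/funext => x /=; rewrite permM permE.
  - by rewrite qE; apply/funext => x /=; rewrite permM permE.
have [q' pq'] := extend_total (op fF p).
rewrite (_ : op fF q = q') //; apply/val_inj/funext => y /=.
have: val q' y \in finrange (val (op fF p)) by rewrite (extend_finrange pq') finrange_in.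
by rewrite inE fc => /asboolP[x <-] /=; rewrite fc.
Qed.

End Matching.

Lemma census_isomorphic (P Q : countableSubdirectPower F) :
  census P = census Q -> isomorphic P Q.
Proof.
move=> ePQ.
have cardPQ B : @orbit_reps P B #= @orbit_reps Q B.
  apply: card_eq_trans (svalP (cid (census_exists P)) B) _.
  rewrite -[sval _]/(census P) ePQ card_eq_sym.
  exact: (svalP (cid (census_exists Q)) B).
have /choice[M MP] B := card_eq_matching (cardPQ B).
pose R r r' := exists B, M B r r'.
have RP r r' : R r r' -> orbit_reps (finrange r) r /\ orbit_reps (finrange r) r'.
  by move=> [B Mr]; have [/(_ _ _ Mr)[[? ? rB] [? ? ?]] _ _ _ _] := MP B; rewrite rB.
have RB r r' : R r r' -> M (finrange r) r r'.
  by move=> [B Mr]; have [/(_ _ _ Mr)[[? ? ->] _] _ _ _ _] := MP B.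
have Rim r r' : R r r' -> finrange r = finrange r' by move=> /RP[_ [_ _ ->]].
have Rfun r r' r'' : R r r' -> R r r'' -> r' = r''.
  by move=> /RB h /RB; have [_ _ _ + _] := MP (finrange r); apply.
have Rinj r t r' : R r r' -> R t r' -> r = t.
  move=> Rr Rt; have := RB _ _ Rt; rewrite (Rim _ _ Rt) -(Rim _ _ Rr).
  by have [_ _ _ _ +] := MP (finrange r); apply; apply: RB.
have Rtot r : universe P r -> orbit_rep r = r -> exists r', R r r'.
  move=> Pr rr; have [_ /(_ r)[//|r' Mr] _ _ _] := MP (finrange r).
  by exists r', (finrange r).
have Rsurj r : universe Q r -> orbit_rep r = r -> exists r', R r' r.
  move=> Pr rr; have [_ _ /(_ r)[//|r' Mr] _ _] := MP (finrange r).
  by exists r', (finrange r).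
pose R' r' r := R r r'.
have flip p q : extend R p q <-> extend R' q p.
  by split=> -[s [r [r' [? ? ? ?]]]]; exists s, r', r.
have [phi phi_bij phiP] : exists2 phi : universe P -> universe Q,
    bijective phi & forall p, extend R p (phi p).
  apply: bijective_of_matching.
  - by apply: extend_total => // r r' /RP[_ []].
  - move=> q; have [||p] := @extend_total Q P R' _ _ q.
    + by move=> r r' /RP[[]].
    + exact: Rsurj.
    + by exists p; apply/flip.
  - by apply: extend_fun => // r r' /RP[[]].
  - move=> p p' q /flip h /flip; apply: extend_fun h => //.
    + by move=> r r' /Rim.
    + by move=> r r' /RP[_ []].
    + by move=> r r' r''; apply: Rinj.
exists phi; split=> // f fF p.
apply: (@extend_fun _ _ R _ _ _ (op fF p)) => //; first by move=> r r' /RP[[]].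
by apply: extend_op => // r r' /RP[] // _ [].
Qed.

Lemma isomorphic_trans (P Q S : countableSubdirectPower F) :
  isomorphic P Q -> isomorphic Q S -> isomorphic P S.
Proof.
move=> [phi [bphi phiE]] [psi [bpsi psiE]]; exists (psi \o phi); split.
  exact: bij_comp.
by move=> f fF p /=; rewrite phiE psiE.
Qed.

(** By [census_isomorphic], the class of [P] is recovered from [census P] as the
    set of powers isomorphic to some power with that census. *)
Lemma countable_iso_class :
  countable [set iso_class P | P in [set: countableSubdirectPower F]].
Proof.
pose h t : set (countableSubdirectPower F) :=
  [set Q | exists2 P, census P = t & isomorphic P Q].
apply: (@sub_countable _ _ _ (h @` setT)); last first.
  exact: sub_countable (card_image_le _ _) (countableP _).
apply: subset_card_le => _ [P _ <-]; exists (census P) => //.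
apply/seteqP; split=> Q; last by exists P.
move=> [P' eP]; apply: isomorphic_trans; exact: census_isomorphic.
Qed.

End BijectiveOrConstant.

(** * A mixed operation: uncountably many powers *)

Section NonInjective.
Local Open Scope card_scope.
Context (A : finType) (F : {set {ffun A -> A}}) (f : {ffun A -> A}).
Hypothesis fF : f \in F.

Lemma card_le_inj (T U : Type) (C : set T) (D : set U) (g : T -> U) :
  {in C &, injective g} -> (forall t, C t -> D (g t)) -> C #<= D.
Proof.
move=> gI CD; rewrite -(card_le_eql (inj_card_eq gI)).
by apply: subset_card_le => _ [t /CD Dt <-].
Qed.

Definition fibre (P : countableSubdirectPower F) (p : index_set P -> A) :
    set (index_set P -> A) :=
  [set q | universe P q /\ f \o q = p].
Arguments fibre P p : clear implicits.

Lemma isomorphic_fibre (P Q : countableSubdirectPower F) p :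
  isomorphic P Q -> universe P p ->
  exists2 q, universe Q q & fibre P p #= fibre Q q.
Proof.
have fibE (S : countableSubdirectPower F) (r : universe S) :
    fibre S (val r) #= [set t : universe S | op fF t = r].
  have -> : fibre S (val r) = val @` [set t : universe S | op fF t = r].
    apply/seteqP; split=> [t [St ft]|_ [t <- <-]].
      by exists (SigSub (mem_set St)) => //; apply: val_inj.
    by split=> //; apply: set_valP.
  by apply: inj_card_eq => t u _ _; apply: val_inj.
move=> [phi [bphi phiE]] Pp; pose p' : universe P := SigSub (mem_set Pp).
exists (val (phi p')); first exact: set_valP.
apply: card_eq_trans (fibE P p') _; rewrite card_eq_sym.
apply: card_eq_trans (fibE Q (phi p')) _.
have -> : [set t | op fF t = phi p'] = phi @` [set t | op fF t = p'].
  apply/seteqP; split=> [t /= tp|_ [t /= <- <-]]; last by rewrite -phiE.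
  have [psi phiK psiK] := bphi; exists (psi t) => //=.
  by apply: (bij_inj bphi); rewrite phiE psiK.
by apply: inj_card_eq => t u _ _; apply: bij_inj.
Qed.

(** An assignment gives a value in [A] to each variable [(k, i)], in such a way
    that [f] takes a single value on each block [k].  Assignments are the
    coordinates of the powers below, and the element [gen k i] is the variable
    [(k, i)] itself.  Values are coded as natural numbers via [enum_val] in order
    that the type of assignments lies in [Set], below the universe of index sets,
    for [A] in any universe. *)
Record assignment : Set := Assignment {
  code : nat -> nat -> nat;
  code_lt : forall k i, (code k i < #|A|)%N;
  code_block : forall k i j,
    f (enum_val (Ordinal (code_lt k i))) = f (enum_val (Ordinal (code_lt k j)))
}.

Definition gen (k i : nat) (x : assignment) : A :=
  enum_val (Ordinal (code_lt x k i)).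

Lemma gen_block k i j (x : assignment) : f (gen k i x) = f (gen k j x).
Proof. exact: code_block. Qed.

Lemma gen_realize (y : nat -> nat -> A) :
  (forall k i j, f (y k i) = f (y k j)) ->
  exists x, forall k i, gen k i x = y k i.
Proof.
move=> yP.
pose lt k i := ltn_ord (enum_rank (y k i)).
have yE k i : enum_val (Ordinal (lt k i)) = y k i.
  by rewrite -[RHS]enum_rankK; congr enum_val; apply: val_inj.
have cP k i j : f (enum_val (Ordinal (lt k i))) = f (enum_val (Ordinal (lt k j))).
  by rewrite !yE.
by exists (Assignment cP) => k i; rewrite /gen /= yE.
Qed.

Lemma gen_onto_block k i j (a b : A) : i != j -> f a = f b ->
  exists x, gen k i x = a /\ gen k j x = b.
Proof.
move=> ij fab; pose y (l n : nat) := if n == j then b else a.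
have [l m n|x xE] := @gen_realize y; first by rewrite /y; do 2 case: ifP.
by exists x; rewrite !xE /y eqxx (negPf ij).
Qed.

Lemma gen_onto_indep k l i j (a b : A) : k != l ->
  exists x, gen k i x = a /\ gen l j x = b.
Proof.
move=> kl; have [//|x xE] := @gen_realize (fun m n => if m == l then b else a).
by exists x; rewrite !xE eqxx (negPf kl).
Qed.

Section Power.
Variable s : nat -> nat.

Definition power_set : set (assignment -> A) :=
  [set p | exists (g : {ffun A -> A}) k i, (i < s k)%N /\ p = g \o gen k i].

Lemma power_closed (h : {ffun A -> A}) : h \in F ->
  forall p, power_set p -> power_set (h \o p).
Proof.
move=> _ _ [g [k [i [ik ->]]]]; exists [ffun a => h (g a)], k, i; split=> //.
by apply/funext => x /=; rewrite ffunE.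
Qed.

Lemma power_countable : countable power_set.
Proof.
pose e (t : {ffun A -> A} * (nat * nat)) := t.1 \o gen t.2.1 t.2.2.
apply: (@sub_countable _ _ _ (e @` setT)); last first.
  exact: sub_countable (card_image_le _ _) (countableP _).
by apply: subset_card_le => _ [g [k [i [_ ->]]]]; exists (g, (k, i)).
Qed.

Hypothesis s_gt0 : forall k, (0 < s k)%N.

Lemma power_onto (x : assignment) : [set p x | p in power_set] = setT.
Proof.
apply/seteqP; split=> // a _; exists ([ffun=> a] \o gen 0 0) => /=.
  by exists [ffun=> a], 0, 0; split.
by rewrite ffunE.
Qed.

Definition power : countableSubdirectPower F :=
  CountableSubdirectPower power_closed power_onto power_countable.

End Power.

Notation N := #|{ffun A -> A}|.

(** The part of block [k] that comes from the variables listed in [J]. *)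
Definition spanned (k : nat) (J : seq nat) : set (assignment -> A) :=
  [set q | exists (h : {ffun A -> A}) j, j \in J /\ q = h \o gen k j].

Lemma card_spanned k J : spanned k J #<= `I_(N * size J).
Proof.
pose T : finType := ({ffun A -> A} * 'I_(size J))%type.
pose e (t : T) := t.1 \o gen k (tnth (in_tuple J) t.2).
have -> : (N * size J)%N = #|T| by rewrite card_prod card_ord.
apply: (@card_le_trans _ _ _ (e @` setT)).
  by apply: subset_card_le => _ [h [_ [/seq_tnthP[j ->] ->]]]; exists (h, j).
apply: card_le_trans (card_image_le _ _) _.
apply: (@card_le_inj _ _ _ _ (fun t : T => val (enum_rank t))) => [t u _ _|t _ /=].
  by move=> /val_inj/enum_rank_inj.
exact: ltn_ord.
Qed.

Section Fibres.
Variables (s : nat -> nat) (s_gt0 : forall k, (0 < s k)%N).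
Notation P := (power s_gt0).

(** If [f] takes the value [c] at two points, a two-valued map onto these points
    yields an element of the fibre for each of the infinitely many blocks;
    otherwise every element of the fibre is the same constant. *)
Lemma fibre_const (c : A) :
  fibre P (fun=> c) #<= `I_1 \/ [set: nat] #<= fibre P (fun=> c).
Proof.
have [[u [v [uv fu fv]]]|inj] :=
  pselect (exists u v, [/\ u <> v, f u = c & f v = c]).
  right; pose h := [ffun y => if y == u then u else v].
  have fh a : f (h a) = c by rewrite ffunE; case: ifP.
  have gI : injective (fun k => h \o gen k 0).
    move=> k l e; apply/eqP; apply: contra_notT uv => kl.
    have [x [xk xl]] := gen_onto_indep 0 0 u v kl.
    have := congr1 (@^~ x) e; rewrite /= xk xl !ffunE eqxx.
    by case: eqP.
  apply: (@card_le_inj _ _ _ _ (fun k => h \o gen k 0)) => [k l _ _|k _].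
    exact: gI.
  split; last by apply/funext => x /=.
  by exists h, k, 0; split.
left; have [->|/set0P[q qc]] := eqVneq (fibre P (fun=> c)) set0.
  exact: card_ge0.
rewrite -(card_le_eqr (@card_set1 _ q)); apply: subset_card_le => q' q'c.
apply/funext => x; apply: contrapT => qq'; apply: inj.
exists (q' x), (q x); split=> //.
  by have := congr1 (@^~ x) q'c.2.
by have := congr1 (@^~ x) qc.2.
Qed.

(** Variables of distinct blocks vary independently, so an equation
    [f \o h \o gen l j = g \o gen k i] with [k] and [l] distinct forces [g] to be
    constant. *)
Lemma fibre_block k i (g : {ffun A -> A}) (u v : A) : g u <> g v ->
  fibre P (g \o gen k i) `<=` spanned k (iota 0 (s k)).
Proof.
move=> guv _ [[h [l [j [jl ->]]]] e].
have [kl|/eqP kl] := pselect (k = l).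
  by subst l; exists h, j; rewrite mem_iota.
exfalso; apply: guv.
have [x [xk xl]] := gen_onto_indep i j u u kl.
have [y [yk yl]] := gen_onto_indep i j v u kl.
have := congr1 (@^~ x) e; have := congr1 (@^~ y) e.
by rewrite /= xk xl yk yl => -> ->.
Qed.

Lemma fibre_upper k i (g : {ffun A -> A}) (u v : A) : g u <> g v ->
  fibre P (g \o gen k i) #<= `I_(N * s k).
Proof.
move=> guv; rewrite -[in X in `I_X](size_iota 0 (s k)).
apply: card_le_trans (card_spanned k _).
exact/subset_card_le/(fibre_block guv).
Qed.

(** When [h] separates two points that [f] identifies, the elements [h \o gen k j]
    are pairwise distinct: two variables of a block can take these two values. *)
Lemma gens_lower k (h : {ffun A -> A}) (u v : A) (E : set (assignment -> A)) :
  f u = f v -> h u <> h v ->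
  (forall j, (j < s k)%N -> E (h \o gen k j)) -> `I_(s k) #<= E.
Proof.
move=> fuv huv sub.
apply: (@card_le_inj _ _ _ _ (fun j => h \o gen k j)) => [i j _ _ e|j /sub//].
apply/eqP; apply: contra_notT huv => ij.
have [x [xi xj]] := gen_onto_block k ij fuv.
by have := congr1 (@^~ x) e; rewrite /= xi xj.
Qed.

(** If every element of the fibre is a function of [gen k i], there are at most [N]
    of them.  Otherwise some [h \o gen k j] in the fibre, with [j] other than [i],
    is not a function of [gen k i].  Genericity shows that [f \o h] and [g] are
    equal and constant on the classes of the kernel of [f], so that the fibre
    contains [h \o gen k l] for all [l]; and [h] separates two points of such a
    class, since otherwise [h \o gen k j = h \o gen k i]. *)
Lemma fibre_dichotomy k i (g : {ffun A -> A}) (u v : A) : g u <> g v ->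
  fibre P (g \o gen k i) #<= `I_N \/ `I_(s k) #<= fibre P (g \o gen k i).
Proof.
move=> guv.
have [sub|nsub] := pselect (fibre P (g \o gen k i) `<=` spanned k [:: i]).
  left; apply: card_le_trans (subset_card_le sub) _.
  by have := card_spanned k [:: i]; rewrite muln1.
right.
have [q qF qC] : exists2 q, fibre P (g \o gen k i) q & ~ spanned k [:: i] q.
  apply: contrapT => H; apply: nsub => q qF.
  by apply: contrapT => qC; apply: H; exists q.
have [h [j [jk qE]]] := fibre_block guv qF; subst q; clear jk.
have ij : i != j.
  by apply: contra_notN qC => /eqP ->; exists h, j; rewrite inE.
have gE a b : f a = f b -> f (h b) = g a.
  move=> fab; have [x [xi xj]] := gen_onto_block k ij fab.
  by have := congr1 (@^~ x) qF.2; rewrite /= xi xj.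
have [[a [b [fab hab]]]|hf] := pselect (exists a b, f a = f b /\ h a <> h b).
  apply: (gens_lower fab hab) => l lk; split; first by exists h, k, l.
  by apply/funext => x /=; apply: gE; exact: gen_block.
exfalso; apply: qC; exists h, i; rewrite inE; split=> //.
apply/funext => x /=; apply: contrapT => hx.
by apply: hf; exists (gen k j x), (gen k i x); split=> //; exact: gen_block.
Qed.

End Fibres.

(** The powers of [N.+1] are spread out enough for the intervals from
    [N.+1 ^ k.+1] to [N * N.+1 ^ k.+1] to be disjoint and to lie above [N]. *)
Definition block_size (w : nat -> bool) (k : nat) : nat :=
  if w k then N.+1 ^ k.+1 else 1.

Lemma block_size_gt0 w k : (0 < block_size w k)%N.
Proof. by rewrite /block_size; case: ifP => // _; rewrite expn_gt0. Qed.

Definition coded_power (w : nat -> bool) : countableSubdirectPower F :=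
  power (block_size_gt0 w).

Definition marked (P : countableSubdirectPower F) (k : nat) : Prop :=
  exists p, [/\ universe P p, `I_(N.+1 ^ k.+1) #<= fibre P p &
    fibre P p #<= `I_(N * N.+1 ^ k.+1)].

Lemma marked_isomorphic P Q k : isomorphic P Q -> marked P k -> marked Q k.
Proof.
move=> PQ [p [Pp lo up]]; have [q Qq pq] := isomorphic_fibre PQ Pp.
by exists q; split=> //; rewrite -?(card_le_eqr pq) -?(card_le_eql pq).
Qed.

Lemma N_gt0 : (0 < N)%N.
Proof. by apply/card_gt0P; exists f. Qed.

Hypothesis f_not_inj : exists a b, a <> b /\ f a = f b.
Hypothesis f_not_const : exists a b, f a <> f b.

Lemma markedE w k : marked (coded_power w) k <-> w k.
Proof.
have big : (N < N.+1 ^ k.+1)%N by rewrite expnS leq_pmulr // expn_gt0.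
have le_exp m n : (N.+1 ^ m.+1 <= N * N.+1 ^ n.+1)%N -> (m <= n)%N.
  move=> h; rewrite -2!ltnS -(@ltn_exp2l N.+1) ?ltnS ?N_gt0 //.
  apply: leq_ltn_trans h _.
  by rewrite [ltnRHS]expnS ltn_mul2r expn_gt0 /=.
split=> [[_ [[g [l [i [il ->]]]] lo up]]|wk].
  have [[u [v guv]]|gc] := pselect (exists u v, g u <> g v).
    have [small|large] := fibre_dichotomy (block_size_gt0 w) l i guv.
      have := card_le_trans lo small.
      by rewrite card_le_II leqNgt big.
    have := card_le_trans lo (fibre_upper (block_size_gt0 w) l i guv).
    have := card_le_trans large up.
    rewrite !card_le_II /block_size; case: ifP => [wl lk kl|_ _].
      suff -> : k = l by [].
      by apply/eqP; rewrite eqn_leq; apply/andP; split; apply: le_exp.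
    by rewrite muln1 leqNgt big.
  (* Here [g] is constant, and the fibre has neither at most one nor infinitely
     many elements. *)
  have [a [b _]] := f_not_inj.
  have gE : g \o gen l i = fun=> g a.
    apply/funext => x /=; apply: contrapT => ga.
    by apply: gc; exists (gen l i x), a.
  rewrite gE in lo up.
  have [/(card_le_trans lo)|/card_le_trans/(_ up)] :=
    fibre_const (block_size_gt0 w) (g a).
    by rewrite card_le_II leqNgt (leq_ltn_trans N_gt0).
  move=> /(card_le_trans (card_leT `I_(N * N.+1 ^ k.+1).+1)).
  by rewrite card_le_II ltnn.
(* The identity map separates [a] and [b]: it plays the role of [h] in [gens_lower]. *)
have [a [b [ab fab]]] := f_not_inj; have [u [v fuv]] := f_not_const.
exists (f \o gen k 0); split.
- by exists f, k, 0; rewrite block_size_gt0.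
- have -> : (N.+1 ^ k.+1)%N = block_size w k by rewrite /block_size wk.
  apply: (@gens_lower (block_size w) k [ffun y => y] a b) => //; first by rewrite !ffunE.
  move=> j jk; split; first by exists [ffun y => y], k, j.
  by apply/funext => x /=; rewrite ffunE; apply: gen_block.
- have := fibre_upper (block_size_gt0 w) k 0 fuv.
  by rewrite /block_size wk.
Qed.

Lemma coded_power_inj w w' : isomorphic (coded_power w) (coded_power w') ->
  isomorphic (coded_power w') (coded_power w) -> w = w'.
Proof.
move=> ww' w'w; apply/funext => k.
by apply/idP/idP => /markedE/marked_isomorphic => [/(_ _ ww')|/(_ _ w'w)] /markedE.
Qed.

Lemma isomorphic_refl (P : countableSubdirectPower F) : isomorphic P P.
Proof. by exists id; split=> //; exists id. Qed.

Lemma uncountable_iso_class :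
  ~ countable [set iso_class P | P in [set: countableSubdirectPower F]].
Proof.
move=> /countable_injP[e eI].
pose h w := e (iso_class (coded_power w)).
have hI w w' : h w = h w' -> w = w'.
  move=> /eI ee; have {}ee : iso_class (coded_power w) = iso_class (coded_power w').
    by apply: ee; apply/mem_set; [exists (coded_power w)|exists (coded_power w')].
  apply: coded_power_inj.
    by rewrite -[isomorphic _ _]/(iso_class _ _) ee; apply: isomorphic_refl.
  by rewrite -[isomorphic _ _]/(iso_class _ _) -ee; apply: isomorphic_refl.
(* Diagonal argument against the injection [h] from subsets of [nat] to [nat]. *)
pose d n := `[< exists w, h w = n /\ ~~ w n >].
have [dd|ndd] := boolP (d (h d)).
  by move: (dd) => /asboolP[w [/hI ->]]; rewrite dd.
by move: (ndd) => /asboolPn; apply; exists d.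
Qed.

End NonInjective.

Unset Implicit Arguments.

Theorem mainTheorem1 (A : finType) (F : {set {ffun A -> A}}) :
  countable [set iso_class P | P in [set: countableSubdirectPower F]] <->
  (forall f : {ffun A -> A}, f \in F ->
     bijective f \/ exists c : A, forall a : A, f a = c).
Proof.
split=> [cnt f fF|]; last exact: countable_iso_class.
apply: contrapT => /not_orP[nbij nconst].
have [a [b [ab fab]]] : exists a b, a <> b /\ f a = f b.
  apply: contrapT => inj; apply: nbij; apply: injF_bij => a b fab.
  by apply: contrapT => ab; apply: inj; exists a, b.
apply: (uncountable_iso_class fF _ _ cnt); first by exists a, b.
apply: contrapT => same; apply: nconst; exists (f a) => c.
by apply: contrapT => fca; apply: same; exists c, a.
Qed.
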